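(* Let $n\ge 1$ be an integer, let $\mathbb{H}^n$ be the Heisenberg group with homogeneous dimension $Q=2n+2$, and assume $Q>4$. Let $\alpha\in\mathbb{R}$ satisfy $\alpha\le \frac{2Q}{Q-4}$. Then there is no function $u\in\Gamma_2$ with $u<0$ everywhere on $\mathbb{H}^n$ satisfying $$\sigma_2(\mathrm{Hess}_X u)=(-u)^{\alpha}\quad\text{on all of } \mathbb{H}^n .$$ Here $\Gamma_2=\{u\in C^2(\mathbb{H}^n)\mid \sigma_l(\mathrm{Hess}_X u)\ge 0 \text{ on } \mathbb{H}^n,\ l=1,2\}$.
   Context: The Heisenberg group $\mathbb{H}^n$ is $\mathbb{R}^n\times\mathbb{R}^n\times\mathbb{R}=\mathbb{R}^{2n+1}$ with points $g=(x,y,t)$ and group law $$(x,y,t)\circ(x_0,y_0,t_0)=\big(x+x_0,\;y+y_0,\;t+t_0+2(\langle y,x_0\rangle-\langle x,y_0\rangle)\big),$$ where $\langle\cdot,\cdot\rangle$ is the standard inner product on $\mathbb{R}^n$. Its homogeneous dimension is $Q=2n+2$. For $i,j=1,\dots,n$ the horizontal left-invariant vector fields are $$X_i=\frac{\partial}{\partial x_i}+2y_i\frac{\partial}{\partial t},\qquad X_{n+j}=\frac{\partial}{\partial y_j}-2x_j\frac{\partial}{\partial t}.$$ For a real-valued $u\in C^2(\mathbb{H}^n)$, the symmetrized horizontal Hessian is the symmetric $2n\times 2n$ matrix $$\mathrm{Hess}_X u=\left[\frac{X_iX_ju+X_jX_iu}{2}\right]_{i,j=1,\dots,2n}.$$ For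 a symmetric matrix $A$, $\sigma_l(A)$ denotes the sum of all $l\times l$ principal minors of $A$; thus $\sigma_1(A)$ is the trace of $A$ and $\sigma_2(A)=\frac12\sum_{i\ne j}(a_{ii}a_{jj}-a_{ij}a_{ji})$. *)

(* Defs.v *)
From HB Require Import structures.
From mathcomp Require Import all_boot all_order all_algebra.
From mathcomp Require Import all_classical all_reals all_analysis.
From mathcomp Require Import ring.

Set Implicit Arguments.
Unset Strict Implicit.
Unset Printing Implicit Defensive.

Import Order.TTheory GRing.Theory Num.Theory.
Import numFieldNormedType.Exports.

Local Open Scope classical_set_scope.
Local Open Scope ring_scope.

(* On a finite-dimensional space these are the usual classes C^1 and C^2: all
   partial derivatives (of order 1, resp. up to 2) exist and are continuous. *)
Definition classC1 (R : realType) (V : normedModType R) (f : V -> R) : Prop :=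
  (forall p, differentiable f p) /\
  (forall v, continuous (fun p => 'D_v f p)).

Definition classC2 (R : realType) (V : normedModType R) (f : V -> R) : Prop :=
  classC1 f /\ (forall v, classC1 (fun p => 'D_v f p)).

(* The sum of the l x l principal minors of A; the rows and columns of each
   minor are selected by a set S of l indices, enumerated increasingly. *)
Definition sigma (R : comNzRingType) (m l : nat) (A : 'M[R]_m) : R :=
  \sum_(S : {set 'I_m} | #|S| == l)
    \det (mxsub (fun i : 'I_#|S| => enum_val i) (fun i => enum_val i) A).

(* Points of H^n are triples (x, y, t); the topology and the norm are those of
   the product R^n * R^n * R. *)
Notation heis R n := ('rV[R]_n * 'rV[R]_n * R)%type.

Definition homdim (n : nat) : nat := (2 * n + 2)%N.

Section Heisenberg.
Context {R : realType} {n : nat}.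

Definition dotv (a b : 'rV[R]_n) : R := \sum_(i < n) a 0 i * b 0 i.

Definition heis_mul (g h : heis R n) : heis R n :=
  let: (x, y, t) := g in let: (x0, y0, t0) := h in
  (x + x0, y + y0, t + t0 + 2 * (dotv y x0 - dotv x y0)).

Definition ex (i : 'I_n) : heis R n := (delta_mx 0 i, 0, 0).
Definition ey (j : 'I_n) : heis R n := (0, delta_mx 0 j, 0).
Definition et : heis R n := (0, 0, 1).

(* The index k < n stands for X_(k+1), and the index n + j for X_(n+j+1). *)
Definition hfield (k : 'I_(n + n)) (u : heis R n -> R) (p : heis R n) : R :=
  match fintype.split k with
  | inl i => 'D_(ex i) u p + 2 * p.1.2 0 i * 'D_et u p
  | inr j => 'D_(ey j) u p - 2 * p.1.1 0 j * 'D_et u p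
  end.

Lemma hfield_left_invariant (g : heis R n) (k : 'I_(n + n))
    (u : heis R n -> R) (p : heis R n) :
  differentiable u (heis_mul g p) ->
  hfield k (fun q => u (heis_mul g q)) p = hfield k u (heis_mul g p).
Proof.
case: g p => [[x0 y0] t0] [[x y] t] du; set G := (x0, y0, t0).
pose dL (v : heis R n) : heis R n :=
  (v.1.1, v.1.2, v.2 + 2 * (dotv y0 v.1.1 - dotv x0 v.1.2)).
have DL v : 'D_v (fun q => u (heis_mul G q)) (x, y, t) =
            'D_(dL v) u (heis_mul G (x, y, t)).
  rewrite /derive; apply: (congr1 (fun f : R -> R => lim (f @ 0^'))).
  apply/funext => h /=.
  congr (_ *: (u _ - _)); case: v => [[a b] c] /=.
  have dD s (w w' : 'rV[R]_n) : dotv s (h *: w + w') = h * dotv s w + dotv s w'.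
    rewrite /dotv mulr_sumr -big_split; apply: eq_bigr => i _ /=.
    by rewrite !mxE mulrDr mulrCA.
  rewrite !dD; congr (_, _, _) => /=; [by rewrite addrCA|by rewrite addrCA|].
  by rewrite /GRing.scale /=; ring.
have dot_delta s (i : 'I_n) : dotv s (delta_mx 0 i) = s 0 i.
  rewrite /dotv (bigD1 i) //= mxE !eqxx mulr1 big1 ?addr0 // => j ji.
  by rewrite mxE (negbTE ji) andbF mulr0.
have dot0 s : dotv s 0 = 0.
  by rewrite /dotv big1 // => j _; rewrite mxE mulr0.
have Dlin v c : 'D_(v + c *: et) u (heis_mul G (x, y, t)) =
    'D_v u (heis_mul G (x, y, t)) + c * 'D_et u (heis_mul G (x, y, t)).
  by rewrite !deriveE // linearD linearZ.
have dLt : dL et = et.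
  by rewrite /dL /et /= !dot0 subrr mulr0 addr0.
have dLx i : dL (ex i) = ex i + (2 * y0 0 i) *: et.
  rewrite /dL /ex /et /= dot_delta dot0 subr0 add0r.
  congr (_, _, _) => /=; rewrite ?scaler0 ?addr0 //.
  by rewrite add0r -[RHS]/(_ * 1) mulr1.
have dLy j : dL (ey j) = ey j + (- (2 * x0 0 j)) *: et.
  rewrite /dL /ey /et /= dot_delta dot0 add0r.
  congr (_, _, _) => /=; rewrite ?scaler0 ?addr0 //.
  by rewrite !add0r -[RHS]/(_ * 1) mulr1 mulrN.
rewrite /hfield; case: (fintype.split k) => i; rewrite !DL dLt ?dLx ?dLy Dlin /= mxE.
  by ring.
by ring.
Qed.

Definition hess (u : heis R n -> R) (p : heis R n) : 'M[R]_(n + n) :=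
  \matrix_(i, j)
    ((hfield i (hfield j u) p + hfield j (hfield i u) p) / 2).

Definition Gamma2 (u : heis R n -> R) : Prop :=
  classC2 u /\
  (forall l : nat, (1 <= l <= 2)%N -> forall p, 0 <= sigma l (hess u p)).

End Heisenberg.

(* Main.v *)
From HB Require Import structures.
Require Import Defs.
From mathcomp Require Import all_boot all_order all_algebra.
From mathcomp Require Import all_classical all_reals all_analysis.
From mathcomp Require Import ring lra.

Set Implicit Arguments.
Unset Strict Implicit.
Unset Printing Implicit Defensive.

Import Order.TTheory GRing.Theory Num.Theory.
Import numFieldNormedType.Exports.

Local Open Scope ring_scope.

(** Put v = -u > 0. The theorem follows from the maximum principle alone, by
    comparing v with powers of the gauge
      phi(x,y,t) = (|x|^2 + |y|^2)^2 + t^2,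
    whose fourth root is homogeneous of degree one under Heisenberg dilations.

    Fix lam > 0 and s > 0 and suppose that v touches C ((lam + phi)^(-s) - eps)
    from above at a point p. Along a horizontal line through p, which is a
    straight line of R^(2n+1), the second derivative test bounds the quadratic
    form of Hess_X u by that of Hess_X (- C (lam + phi)^(-s)), an explicit
    matrix ([hess_le_at_contact]). On symmetric matrices sigma_2 is monotone
    above any matrix with sigma_1, sigma_2 >= 0 ([sigma2_le]), so v(p)^alpha =
    sigma_2(Hess_X u)(p) is at most the sigma_2 of the explicit matrix, which is
    a nonnegative multiple of
      2n^2 + 7n - 4 (s+1) (2n+1) phi / (lam + phi)
    ([sigma2_gauge_hess]). Choose s with 4 (s+1) (2n+1) = K + 1, where
    K = 2n^2 + 7n. As v(p)^alpha > 0, contact can only occur where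
    phi < K lam, and there v(p)^alpha <= const C^2 (lam + phi)^(-2s) / lam
    ([contact_estimate]).

    Such contact points exist for every lam and every small eps, because the
    comparison function is positive only on a bounded set ([contact_exists]).
    With lam = 1 and eps tending to 0 they give v >= m (1 + phi)^(-s)
    ([solution_lower_bound]). With lam large they give points p where
      v(p)^alpha <= const v(p)^2 / lam  and  m' lam^(-s) <= v(p) <= v(0)
    ([solution_scaled_values]). This is absurd for large lam as soon as
    s (alpha - 2) < 1 ([subcritical_contradiction]).

    The choice of s satisfies 4 s = n - 1 - 2 / (2n+1) < n - 1 = (Q - 4) / 2,
    whereas alpha <= 2Q/(Q-4) means alpha - 2 <= 8 / (Q - 4) = 4 / (n - 1).
    So even at the end point exponent the inequality s (alpha - 2) < 1 is
    strict. The reason is that the gauge power with sigma_2 = 0, whose exponent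
    s satisfies 4 s = n - 1 - 3 / (2n+1), decays more slowly than the dimension
    Q suggests; this gap is what makes pointwise comparison sufficient. *)

(** * The elementary symmetric functions sigma_1 and sigma_2 *)

Section Sigma.
Context {R : numFieldType}.

Lemma det1E m (M : 'M[R]_m) : m = 1%N -> \det M = \sum_i M i i.
Proof. by move=> m1; subst m; rewrite det_mx11 big_ord1. Qed.

Lemma det2E m (M : 'M[R]_m) : m = 2%N ->
  \det M = \sum_i \sum_j (M i i * M j j - M i j * M j i) / 2.
Proof.
move=> m2; subst m.
rewrite (expand_det_row _ ord0) !big_ord_recl !big_ord0.
rewrite /cofactor !det_mx11 !mxE /=.
rewrite (_ : lift ord0 (0 : 'I_1) = 1); last exact/val_inj.
rewrite (_ : lift (1 : 'I_2) (0 : 'I_1) = 0); last exact/val_inj.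
have -> : ord0 = 0 :> 'I_2 by exact/val_inj.
rewrite /= /bump /= ?addn0 expr0 expr1.
by field.
Qed.

Lemma sigma1E m (A : 'M[R]_m) : sigma 1 A = \tr A.
Proof.
rewrite /sigma (eq_bigr (fun S : {set 'I_m} => \sum_(i in S) A i i)); last first.
  move=> S /eqP S1; rewrite (det1E _ S1) [RHS]big_enum_val.
  by apply: eq_bigr => i _; rewrite mxE.
rewrite (exchange_big_dep xpredT) //=; apply: eq_bigr => i _.
rewrite (big_pred1 [set i]%SET) // => S.
apply/andP/eqP => [[/cards1P[j ->]]|->]; last by rewrite cards1 inE.
by rewrite inE => /eqP ->.
Qed.

Lemma sigma2E m (A : 'M[R]_m) :
  sigma 2 A = ((\tr A) ^+ 2 - \sum_i \sum_j A i j * A j i) / 2.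
Proof.
pose G i j := (A i i * A j j - A i j * A j i) / 2.
have -> : ((\tr A) ^+ 2 - \sum_i \sum_j A i j * A j i) / 2 = \sum_i \sum_j G i j.
  rewrite /mxtrace expr2 mulr_suml -sumrB mulr_suml; apply: eq_bigr => i _.
  by rewrite mulr_sumr -sumrB mulr_suml.
rewrite /sigma (eq_bigr (fun S : {set 'I_m} =>
    \sum_(i in S) \sum_(j in S) G i j)); last first.
  move=> S /eqP S2; rewrite (det2E _ S2) [RHS]big_enum_val.
  apply: eq_bigr => i _; rewrite [RHS]big_enum_val.
  by apply: eq_bigr => j _; rewrite !mxE.
(* Each pair i != j lies in exactly one set of two indices, and the diagonal
   terms G i i vanish. *)
rewrite (exchange_big_dep xpredT) //=; apply: eq_bigr => i _.
rewrite (exchange_big_dep xpredT) //=; apply: eq_bigr => j _.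
have [<-|ij] := eqVneq i j.
  by rewrite /G subrr mul0r big1.
rewrite (big_pred1 [set i; j]%SET) // => S.
apply/idP/eqP => [|->]; last by rewrite cards2 ij !inE !eqxx orbT.
move=> /andP[/andP[/cards2P[a [b [ab ->]]]]].
rewrite !inE => /orP[]/eqP iE /orP[]/eqP jE.
- by rewrite iE jE eqxx in ij.
- by rewrite iE jE.
- by rewrite iE jE finset.setUC.
- by rewrite iE jE eqxx in ij.
Qed.

End Sigma.

(** * Monotonicity of sigma_2 on the cone Gamma_2 *)

Definition qform (R : pzRingType) m (A : 'M[R]_m) (x : 'rV[R]_m) : R :=
  (x *m A *m x^T) 0 0.

Section SigmaMonotone.
Context {R : realFieldType}.

Lemma qformE m (A : 'M[R]_m) x :
  qform A x = \sum_i \sum_j x 0 i * x 0 j * A i j.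
Proof.
rewrite /qform mxE exchange_big; apply: eq_bigr => j _ /=.
rewrite !mxE mulr_suml; apply: eq_bigr => i _.
by rewrite mulrAC.
Qed.

Lemma qformB m (A B : 'M[R]_m) x : qform (A - B) x = qform A x - qform B x.
Proof. by rewrite /qform mulmxBr mulmxBl !mxE. Qed.

Lemma qform_delta2 m (A : 'M[R]_m) i j s t : (forall i j, A i j = A j i) ->
  qform A (s *: delta_mx 0 i + t *: delta_mx 0 j) =
  s ^+ 2 * A i i + 2 * s * t * A i j + t ^+ 2 * A j j.
Proof.
move=> symA; rewrite /qform linearD !linearZ /= !trmx_delta.
rewrite mulmxDl -!scalemxAl -!rowE mulmxDr -!scalemxAr !mulmxDl -!scalemxAl.
rewrite -!colE !mxE (symA j i); ring.
Qed.

Lemma discriminant_le (a b c : R) :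
  (forall s t, 0 <= s ^+ 2 * a + 2 * s * t * b + t ^+ 2 * c) -> b ^+ 2 <= a * c.
Proof.
move=> h.
have a0 : 0 <= a by have := h 1 0; rewrite expr0n /= expr1n; lra.
have c0 : 0 <= c by have := h 0 1; rewrite expr0n /= expr1n; lra.
have [cE|cN] := eqVneq c 0.
  (* For c = 0 the form at (b, -(a+1)) equals -(a+2) b^2, which forces b = 0. *)
  have := h b (- (a + 1)); rewrite cE => h1.
  have [->|bN] := eqVneq b 0; first by rewrite expr0n /= !mulr0.
  have b2 : 0 < b ^+ 2 by rewrite exprn_even_gt0.
  nra.
have cp : 0 < c by rewrite lt_def cN.
rewrite -subr_ge0 -(pmulr_rge0 _ cp).
by have := h c (- b); rewrite (_ : c ^+ 2 * a + _ + _ = c * (a * c - b ^+ 2)) //; ring.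
Qed.

Lemma cauchy_schwarz (I : finType) (a b : I -> R) :
  (\sum_i a i * b i) ^+ 2 <= (\sum_i a i ^+ 2) * (\sum_i b i ^+ 2).
Proof.
apply: discriminant_le => s t.
rewrite !mulr_sumr -!big_split /=; apply: sumr_ge0 => i _.
rewrite (_ : _ + _ = (s * a i + t * b i) ^+ 2) ?sqr_ge0 //; ring.
Qed.

(** Each 2 x 2 principal minor of a positive semidefinite D is nonnegative, so
    D_ij^2 <= D_ii D_jj; the sum over i, j is the Frobenius bound. *)
Lemma psd_sum_sqr_le m (D : 'M[R]_m) : (forall i j, D i j = D j i) ->
  (forall x, 0 <= qform D x) ->
  0 <= \tr D /\ \sum_i \sum_j D i j ^+ 2 <= (\tr D) ^+ 2.
Proof.
move=> symD psd; split.
  rewrite /mxtrace; apply: sumr_ge0 => i _.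
  have := psd (1 *: delta_mx 0 i + 0 *: delta_mx 0 i).
  rewrite qform_delta2 // expr1n expr0n /=; lra.
rewrite /mxtrace expr2 mulr_suml; apply: ler_sum => i _.
rewrite mulr_sumr; apply: ler_sum => j _.
by apply: discriminant_le => s t; rewrite -qform_delta2.
Qed.

(** With D = B - A positive semidefinite,
      sigma_2 B = sigma_2 A + (tr A tr D - <A, D>) + sigma_2 D.
    The conditions on A say |A| <= tr A for the Frobenius norm, the same holds
    for D, and Cauchy-Schwarz makes the middle term nonnegative. *)
Lemma sigma2_le m (A B : 'M[R]_m) :
    (forall i j, A i j = A j i) -> (forall i j, B i j = B j i) ->
    0 <= sigma 1 A -> 0 <= sigma 2 A ->
    (forall x, qform A x <= qform B x) ->
  sigma 2 A <= sigma 2 B.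
Proof.
move=> symA symB; rewrite sigma1E !sigma2E => trA s2A AB.
pose D := B - A.
have symD i j : D i j = D j i by rewrite !mxE symA symB.
have psd x : 0 <= qform D x by rewrite qformB subr_ge0.
have [trD nD] := psd_sum_sqr_le symD psd.
have sqE (M : 'M[R]_m) : (forall i j, M i j = M j i) ->
    \sum_i \sum_j M i j * M j i = \sum_i \sum_j M i j ^+ 2.
  by move=> h; apply: eq_bigr => i _; apply: eq_bigr => j _; rewrite -h expr2.
rewrite (sqE A) // in s2A *; rewrite (sqE B) //.
have trB : \tr B = \tr A + \tr D by rewrite -mxtraceD addrC subrK.
have nB : \sum_i \sum_j B i j ^+ 2 = \sum_i \sum_j A i j ^+ 2 +
    2 * (\sum_i \sum_j A i j * D i j) + \sum_i \sum_j D i j ^+ 2.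
  rewrite mulr_sumr -!big_split; apply: eq_bigr => i _ /=.
  rewrite mulr_sumr -!big_split; apply: eq_bigr => j _ /=.
  rewrite !mxE; ring.
have cs : (\sum_i \sum_j A i j * D i j) ^+ 2 <=
    (\sum_i \sum_j A i j ^+ 2) * (\sum_i \sum_j D i j ^+ 2).
  by rewrite !pair_big; apply: cauchy_schwarz.
have nD0 : 0 <= \sum_i \sum_j D i j ^+ 2.
  by apply: sumr_ge0 => i _; apply: sumr_ge0 => j _; apply: sqr_ge0.
have cs' : \sum_i \sum_j A i j * D i j <= \tr A * \tr D.
  apply: le_trans (ler_norm _) _.
  rewrite -ler_sqr ?nnegrE ?mulr_ge0 // real_normK ?num_real //.
  apply: le_trans cs _; rewrite exprMn; apply: ler_pM => //.
    by apply: sumr_ge0 => i _; apply: sumr_ge0 => j _; apply: sqr_ge0.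
  lra.
rewrite trB nB; lra.
Qed.

Lemma qformZ m (k : R) (A : 'M[R]_m) x : qform (k *: A) x = k * qform A x.
Proof. by rewrite /qform -scalemxAr -scalemxAl mxE. Qed.

Lemma sigma2Z m (k : R) (A : 'M[R]_m) : sigma 2 (k *: A) = k ^+ 2 * sigma 2 A.
Proof.
rewrite !sigma2E mxtraceZ exprMn.
have -> : \sum_i \sum_j (k *: A) i j * (k *: A) j i =
    k ^+ 2 * \sum_i \sum_j A i j * A j i.
  rewrite mulr_sumr; apply: eq_bigr => i _; rewrite mulr_sumr.
  by apply: eq_bigr => j _; rewrite !mxE; ring.
by ring.
Qed.

End SigmaMonotone.

(** * One-variable calculus *)

Section Calculus.
Local Open Scope classical_set_scope.
Context {R : realType}.

(** If f'' < 0 then f' vanishes at the minimum and is negative just after it,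
    and the mean value theorem contradicts minimality. *)
Lemma second_derivative_test (f f' : R -> R) (f'' : R) :
    (forall t : R, is_derive t 1 f (f' t)) -> is_derive (0 : R) 1 f' f'' ->
    (forall t, f 0 <= f t) ->
  0 <= f''.
Proof.
move=> df df' fmin.
have f'0 : f' 0 = 0.
  have [_ fd] : is_derive (0 : R) 1 f 0.
    apply: (@derive1_at_min R f (-1) 1 0); first by lra.
    - by move=> t _; case: (df t).
    - by rewrite in_itv /=; apply/andP; split; lra.
    - by move=> t _.
  by have [_] := df 0; rewrite fd.
rewrite leNgt; apply/negP => f''0.
have : h^-1 *: (f' (h *: 1 + 0) - f' 0) @[h --> 0^'] --> f''.
  by case: df' => d <-; exact: d.
move=> /cvgr_lt /(_ _ f''0).
rewrite near_withinE => /nbhs_ballP [e /= e0 he].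
have h2 : 0 < e / 2 by lra.
have [|c] := @MVT R f f' 0 (e / 2) h2 (fun x _ => df x).
  apply: continuous_subspaceT => x.
  by apply/differentiable_continuous/derivable1_diffP; case: (df x).
rewrite in_itv /= => /andP[c0 ce]; rewrite subr0 => fE.
have := he c; rewrite /ball /= sub0r normrN gtr0_norm // => /(_ _ (lt0r_neq0 c0)).
rewrite f'0 subr0 addr0 [c *: 1]mulr1 => H.
have {H} : c^-1 * f' c < 0 by apply: H; lra.
rewrite pmulr_rlt0 ?invr_gt0 // => f'c.
have := fmin (e / 2); nra.
Qed.

Lemma is_derive_line (V : normedModType R) (u : V -> R) (p v : V) (t : R) :
  differentiable u (p + t *: v) ->
  is_derive t 1 (fun s => u (p + s *: v)) ('D_v u (p + t *: v)).
Proof.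
move=> du.
have E : (fun h : R => h^-1 *:
      (((fun s => u (p + s *: v)) \o shift t) (h *: 1) - u (p + t *: v))) =
    (fun h : R => h^-1 *: ((u \o shift (p + t *: v)) (h *: v) - u (p + t *: v))).
  apply/funext => h /=; congr (_ *: (u _ - _)).
  by rewrite [h *: 1]mulr1 scalerDl addrCA.
split.
  rewrite /derivable E; exact: diff_derivable.
by rewrite /derive E.
Qed.

End Calculus.

Section PowerTouch.
Context {R : realType}.

(** The second derivative test for f - C P^(-s), solved for f''. *)
Lemma powR_touch_derive2 (P : {poly R}) (s C : R) (f f' : R -> R) (f'' : R) :
    (forall t, 0 < P.[t]) ->
    (forall t : R, is_derive t 1 f (f' t)) -> is_derive (0 : R) 1 f' f'' ->
    (forall t, f 0 - C * P.[0] `^ (- s) <= f t - C * P.[t] `^ (- s)) ->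
  - f'' <= C * s * P.[0] `^ (- s - 1) *
      (P^`()^`().[0] - (s + 1) * P^`().[0] ^+ 2 / P.[0]).
Proof.
move=> P0 df df' fmin.
have dpow (e t : R) : is_derive t 1 (fun x : R => P.[x] `^ e)
    (e * P.[t] `^ (e - 1) * P^`().[t]).
  exact: (is_derive1_comp (is_derive1_powR _ (P0 t))).
pose h1 t := (- s) * P.[t] `^ (- s - 1) * P^`().[t].
have dh (t : R) : is_derive t 1 (fun x : R => f x - C * P.[x] `^ (- s)) (f' t - C * h1 t).
  apply: is_deriveB; apply: is_deriveZ; exact: dpow.
have dh1 : is_derive (0 : R) 1 h1
    ((- s) * ((- s - 1) * P.[0] `^ (- s - 1 - 1) * P^`().[0]) * P^`().[0]
    + (- s) * P.[0] `^ (- s - 1) * P^`()^`().[0]).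
  rewrite (_ : h1 = (- s) \*: ((fun t => P.[t] `^ (- s - 1)) * horner P^`())); last first.
    by apply/funext => t; rewrite /h1 -mulrA.
  apply: is_derive_eq (is_deriveZ _ (is_deriveM (dpow _ _) (is_derive_poly _ _))) _.
  by rewrite /GRing.scale /=; ring.
have := second_derivative_test dh (is_deriveB df' (is_deriveZ C dh1)) fmin.
have -> : P.[0] `^ (- s - 1 - 1) = P.[0] `^ (- s - 1) / P.[0].
  by rewrite powRB ?powRr1 ?(ltW (P0 0)) // (gt_eqF (P0 0)) implybT.
rewrite /GRing.scale /=.
move=> H; rewrite -subr_ge0; apply: le_trans H _.
rewrite le_eqVlt; apply/orP; left; apply/eqP.
have := P0 0; set m := P.[0] => m0.
by field; rewrite gt_eqF.
Qed.

End PowerTouch.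

(** * The horizontal Hessian along horizontal lines *)

Section HorizontalHessian.
Local Open Scope classical_set_scope.
Context {R : realType} {n : nat}.
Implicit Types (xi : 'rV[R]_(n + n)) (p q : heis R n) (u : heis R n -> R).

(** The value at p of the left-invariant field sum_k xi_k X_k. *)
Definition hvec p xi : heis R n :=
  (lsubmx xi, rsubmx xi, 2 * (dotv p.1.2 (lsubmx xi) - dotv p.1.1 (rsubmx xi))).

Lemma dotv_linear (a : 'rV[R]_n) (c : R) (x y : 'rV[R]_n) :
  dotv a (c *: x + y) = c * dotv a x + dotv a y.
Proof.
rewrite /dotv mulr_sumr -big_split; apply: eq_bigr => i _ /=.
by rewrite !mxE; ring.
Qed.

Lemma hvec_is_linear p : linear (hvec p).
Proof.
move=> c x y; rewrite /hvec !linearP !dotv_linear /=.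
congr (_, _, _); rewrite /GRing.scale /= /GRing.scale /=; ring.
Qed.

HB.instance Definition _ p :=
  GRing.isLinear.Build R 'rV[R]_(n + n) (heis R n) _ (hvec p) (hvec_is_linear p).

Lemma dotv_delta (a : 'rV[R]_n) i : dotv a (delta_mx 0 i) = a 0 i.
Proof.
rewrite /dotv (bigD1 i) //= mxE !eqxx mulr1 big1 ?addr0 // => j ji.
by rewrite mxE (negbTE ji) andbF mulr0.
Qed.

Lemma dotv0 (a : 'rV[R]_n) : dotv a 0 = 0.
Proof. by rewrite /dotv big1 // => j _; rewrite mxE mulr0. Qed.

Lemma hfieldE k u p : differentiable u p ->
  hfield k u p = 'D_(hvec p (delta_mx 0 k)) u p.
Proof.
move=> du; rewrite /hfield; case: splitP => i kE.
  have -> : hvec p (delta_mx 0 k) = ex i + (2 * p.1.2 0 i) *: et.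
    have -> : k = lshift n i by exact/val_inj.
    have -> : delta_mx 0 (lshift n i) = row_mx (delta_mx 0 i) 0 :> 'rV[R]_(n + n).
      by rewrite (@delta_mx_lshift R).
    rewrite /hvec row_mxKl row_mxKr dotv_delta dotv0.
    rewrite /ex /et; congr (_, _, _); rewrite /= ?scaler0 ?addr0 //.
    by rewrite subr0 add0r; symmetry; apply: mulr1.
  by rewrite !deriveE // linearD linearZ.
have -> : hvec p (delta_mx 0 k) = ey i - (2 * p.1.1 0 i) *: et.
  have -> : k = rshift n i by exact/val_inj.
  have -> : delta_mx 0 (rshift n i) = row_mx 0 (delta_mx 0 i) :> 'rV[R]_(n + n).
    by rewrite (@delta_mx_rshift R).
  rewrite /hvec row_mxKl row_mxKr dotv_delta dotv0.
  rewrite /ey /et; congr (_, _, _); rewrite /= ?scaler0 ?subr0 //.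
  by rewrite !sub0r mulrN; congr (- _); symmetry; apply: mulr1.
by rewrite !deriveE // [RHS]linearB [in RHS]linearZ.
Qed.

Lemma sum_hfield u p xi : differentiable u p ->
  \sum_k xi 0 k * hfield k u p = 'D_(hvec p xi) u p.
Proof.
move=> du; rewrite [in RHS](row_sum_delta xi) linear_sum deriveE // linear_sum.
apply: eq_bigr => k _; rewrite linearZ /= linearZ /= hfieldE // deriveE //.
Qed.

Lemma differentiable_fst (U W : normedModType R) (x : U * W) :
  differentiable (fst : U * W -> U) x.
Proof. by apply: linear_differentiable => y; exact: cvg_fst. Qed.

Lemma differentiable_snd (U W : normedModType R) (x : U * W) :
  differentiable (snd : U * W -> W) x.
Proof. by apply: linear_differentiable => y; exact: cvg_snd. Qed.

Lemma differentiable_x_coord p i : differentiable (fun q : heis R n => q.1.1 0 i) p.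
Proof.
apply: (@differentiable_comp _ _ _ _ (fun q : heis R n => q.1.1) (fun a => a 0 i)).
  by apply: differentiable_comp; exact: differentiable_fst.
exact: differentiable_coord.
Qed.

Lemma differentiable_y_coord p i : differentiable (fun q : heis R n => q.1.2 0 i) p.
Proof.
apply: (@differentiable_comp _ _ _ _ (fun q : heis R n => q.1.2) (fun a => a 0 i)).
  apply: differentiable_comp; first exact: differentiable_fst.
  exact: differentiable_snd.
exact: differentiable_coord.
Qed.

Lemma differentiable_hfield k u p : classC2 u -> differentiable (hfield k u) p.
Proof.
move=> [_ du2].
have dD v : differentiable (fun q => 'D_v u q) p by case: (du2 v).
have dx i : differentiable (fun q : heis R n => q.1.1 0 i) p.
  exact: differentiable_x_coord.
have dy i : differentiable (fun q : heis R n => q.1.2 0 i) p.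
  exact: differentiable_y_coord.
rewrite /hfield; case: splitP => i _.
  apply: differentiableD => //; apply: differentiableM => //.
  by apply: differentiableM.
apply: differentiableB => //; apply: differentiableM => //.
by apply: differentiableM.
Qed.

(** The horizontal line through p in direction xi is a Euclidean line: the
    symplectic form vanishes on (xi, xi), so the left-invariant field does not
    change along it. *)
Lemma hvec_const_on_line p xi (h : R) :
  hvec (h *: hvec p xi + p) xi = hvec p xi.
Proof.
rewrite /hvec /=; congr (_, _, 2 * _).
have dE (a b c : 'rV[R]_n) : dotv (h *: a + b) c = h * dotv a c + dotv b c.
  rewrite /dotv mulr_sumr -big_split; apply: eq_bigr => i _ /=.
  by rewrite !mxE; ring.
rewrite !dE (_ : dotv (rsubmx xi) _ = dotv (lsubmx xi) (rsubmx xi)); first by ring.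
by apply: eq_bigr => i _; rewrite mulrC.
Qed.

(** Symmetrization does not affect the quadratic form, which is therefore
    X (X u) for the single field X = sum_k xi_k X_k; and X is constant along
    its own integral line. *)
Lemma qform_hess u p xi : classC2 u ->
  qform (hess u p) xi = 'D_(hvec p xi) (fun q => 'D_(hvec p xi) u q) p.
Proof.
move=> C2u; have [[du _] du2] := C2u.
pose F q := \sum_j xi 0 j * hfield j u q.
have FE : F = \sum_j (xi 0 j *: hfield j u).
  by apply/funext => q; rewrite /F fct_sumE.
have dF : differentiable F p.
  rewrite FE; apply: differentiable_sum => j; apply: differentiableZ.
  exact: differentiable_hfield.
have hF i : hfield i F p = \sum_j xi 0 j * hfield i (hfield j u) p.
  rewrite hfieldE // FE derive_sum; last first.
    move=> j; apply/diff_derivable/differentiableZ; exact: differentiable_hfield.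
  apply: eq_bigr => j _; have dj := differentiable_hfield j p C2u.
  rewrite hfieldE // deriveZ //; exact: diff_derivable.
have -> : qform (hess u p) xi = \sum_i xi 0 i * hfield i F p.
  pose T i j := xi 0 i * xi 0 j * hfield i (hfield j u) p.
  transitivity (\sum_i \sum_j (T i j + T j i) / 2).
    rewrite qformE; apply: eq_bigr => i _; apply: eq_bigr => j _.
    by rewrite mxE /T; field.
  transitivity (\sum_i \sum_j T i j); last first.
    apply: eq_bigr => i _; rewrite hF mulr_sumr.
    by apply: eq_bigr => j _; rewrite /T mulrA.
  have E : \sum_i \sum_j (T i j + T j i) = \sum_i \sum_j T i j + \sum_i \sum_j T i j.
    rewrite [X in _ + X]exchange_big -big_split; apply: eq_bigr => i _.
    by rewrite -big_split.
  under eq_bigr do rewrite -mulr_suml.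
  by rewrite -mulr_suml E; field.
rewrite sum_hfield // /derive; apply: (congr1 (fun f : R -> R => lim (f @ 0^'))).
apply/funext => h /=.
by rewrite /F !sum_hfield // hvec_const_on_line.
Qed.

End HorizontalHessian.

(** * Perturbations of a scalar matrix in a plane *)

Section GaugeMatrix.
Context {R : realFieldType}.

(** The matrix a I + p z z^T + q J J^T + r (z J^T + J z^T). The Hessian of a
    function of the gauge has this form. *)
Definition plane_mx N (z J : 'rV[R]_N) (a p q r : R) : 'M[R]_N :=
  \matrix_(i, j) (a * (i == j)%:R + p * (z 0 i * z 0 j) + q * (J 0 i * J 0 j)
                  + r * (z 0 i * J 0 j + J 0 i * z 0 j)).

Lemma qform_plane_mx N (z J xi : 'rV[R]_N) a p q r :
  qform (plane_mx z J a p q r) xi =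
  a * (\sum_i xi 0 i ^+ 2) + p * (\sum_i z 0 i * xi 0 i) ^+ 2
  + q * (\sum_i J 0 i * xi 0 i) ^+ 2
  + 2 * r * (\sum_i z 0 i * xi 0 i) * (\sum_i J 0 i * xi 0 i).
Proof.
set b := \sum_i z 0 i * xi 0 i; set o := \sum_i J 0 i * xi 0 i.
rewrite qformE (eq_bigr (fun i => a * xi 0 i ^+ 2 + (p * b) * (z 0 i * xi 0 i) +
    (q * o) * (J 0 i * xi 0 i) + (r * o) * (z 0 i * xi 0 i)
    + (r * b) * (J 0 i * xi 0 i))).
  rewrite !big_split /= -!mulr_sumr -/b -/o; ring.
move=> i _.
rewrite (eq_bigr (fun j => (if i == j then a * xi 0 i * xi 0 j else 0)
    + p * (z 0 i * xi 0 i) * (z 0 j * xi 0 j)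
    + q * (J 0 i * xi 0 i) * (J 0 j * xi 0 j)
    + r * (z 0 i * xi 0 i) * (J 0 j * xi 0 j)
    + r * (J 0 i * xi 0 i) * (z 0 j * xi 0 j))).
  rewrite !big_split /= -!mulr_sumr -/b -/o -big_mkcond /=.
  rewrite (big_pred1 i) => [|j]; last by rewrite /= eq_sym.
  ring.
by move=> j _; rewrite mxE; case: eqVneq => _ /=; ring.
Qed.

(** As z and J are orthogonal of squared length a, the eigenvalues are a, with
    multiplicity N - 2, and those of a (I + S) with S the 2 x 2 matrix of
    rows (p, r) and (r, q). *)
Lemma sigma2_plane_mx N (z J : 'rV[R]_N) a p q r :
    \sum_i z 0 i ^+ 2 = a -> \sum_i J 0 i ^+ 2 = a -> \sum_i z 0 i * J 0 i = 0 ->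
  sigma 2 (plane_mx z J a p q r) =
  a ^+ 2 / 2 * (N%:R ^+ 2 - N%:R + 2 * (N%:R - 1) * (p + q) + 2 * (p * q - r ^+ 2)).
Proof.
move=> zz JJ zJ; rewrite sigma2E.
have -> : \tr (plane_mx z J a p q r) = a * (N%:R + p + q).
  rewrite /mxtrace (eq_bigr (fun i => a + p * z 0 i ^+ 2 + q * J 0 i ^+ 2
      + (2 * r) * (z 0 i * J 0 i))); last first.
    by move=> i _; rewrite mxE eqxx /=; ring.
  rewrite !big_split /= -!mulr_sumr zz JJ zJ sumr_const card_ord -[a *+ N]mulr_natr; ring.
have -> : \sum_i \sum_j plane_mx z J a p q r i j * plane_mx z J a p q r j i =
    a ^+ 2 * (N%:R + 2 * (p + q) + p ^+ 2 + q ^+ 2 + 2 * r ^+ 2).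
  rewrite (eq_bigr (fun i => a ^+ 2
      + (2 * a * p + a * p ^+ 2 + a * r ^+ 2) * z 0 i ^+ 2
      + (2 * a * q + a * q ^+ 2 + a * r ^+ 2) * J 0 i ^+ 2
      + (4 * a * r + 2 * a * p * r + 2 * a * q * r) * (z 0 i * J 0 i))).
    rewrite !big_split /= sumr_const card_ord -[a ^+ 2 *+ N]mulr_natr.
    rewrite -!mulr_sumr zz JJ zJ; ring.
  move=> i _.
  rewrite (eq_bigr (fun j => (if i == j then a ^+ 2 + 2 * a * p * z 0 j ^+ 2
        + 2 * a * q * J 0 j ^+ 2 + 4 * a * r * (z 0 j * J 0 j) else 0)
      + (p * z 0 i + r * J 0 i) ^+ 2 * z 0 j ^+ 2
      + (q * J 0 i + r * z 0 i) ^+ 2 * J 0 j ^+ 2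
      + 2 * (p * z 0 i + r * J 0 i) * (q * J 0 i + r * z 0 i) * (z 0 j * J 0 j))).
    rewrite !big_split /= -!mulr_sumr zz JJ zJ -big_mkcond /=.
    rewrite (big_pred1 i) => [|j]; last by rewrite /= eq_sym.
    ring.
  by move=> j _; rewrite !mxE eq_sym; case: eqVneq => [->|_] /=; ring.
by field.
Qed.

End GaugeMatrix.

(** * The gauge and its horizontal Hessian *)

Section Gauge.
Local Open Scope classical_set_scope.
Context {R : realType} {n : nat}.
Implicit Types (p q : heis R n) (u : heis R n -> R) (lam s eps : R).

Definition zvec p : 'rV[R]_(n + n) := row_mx p.1.1 p.1.2.
Definition jvec p : 'rV[R]_(n + n) := row_mx p.1.2 (- p.1.1).
Definition zsq p : R := \sum_i zvec p 0 i ^+ 2.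
Definition gauge p : R := zsq p ^+ 2 + p.2 ^+ 2.

Lemma sum_jvec_sqr p : \sum_i jvec p 0 i ^+ 2 = zsq p.
Proof.
rewrite /zsq !big_split_ord /= addrC; congr (_ + _); apply: eq_bigr => i _.
  by rewrite !row_mxEr row_mxEl mxE sqrrN.
by rewrite !row_mxEl row_mxEr.
Qed.

Lemma sum_zvec_jvec p : \sum_i zvec p 0 i * jvec p 0 i = 0.
Proof.
rewrite big_split_ord /= -big_split big1 //= => i _.
by rewrite !row_mxEl !row_mxEr mxE; ring.
Qed.

Lemma zsq_ge0 p : 0 <= zsq p.
Proof. by apply: sumr_ge0 => i _; exact: sqr_ge0. Qed.

Lemma gauge_ge0 p : 0 <= gauge p.
Proof. by rewrite addr_ge0 ?sqr_ge0. Qed.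

Lemma gauge0 : gauge 0 = 0.
Proof.
rewrite /gauge /zsq big1 ?expr0n /= ?addr0 // => i _.
by rewrite /zvec row_mx0 mxE expr0n.
Qed.

(** lam + gauge along the horizontal line through p in direction xi. *)
Definition line_poly lam p (xi : 'rV[R]_(n + n)) : {poly R} :=
  lam%:P
  + ((zsq p)%:P + (2 * \sum_i zvec p 0 i * xi 0 i)%:P * 'X
     + (\sum_i xi 0 i ^+ 2)%:P * 'X^2) ^+ 2
  + ((p.2)%:P + (2 * \sum_i jvec p 0 i * xi 0 i)%:P * 'X) ^+ 2.

Lemma gauge_line lam p xi t :
  lam + gauge (p + t *: hvec p xi) = (line_poly lam p xi).[t].
Proof.
have zE : zsq (p + t *: hvec p xi) = zsq p + 2 * (\sum_i zvec p 0 i * xi 0 i) * t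
    + (\sum_i xi 0 i ^+ 2) * t ^+ 2.
  have -> : zsq (p + t *: hvec p xi) = \sum_i (zvec p 0 i + t * xi 0 i) ^+ 2.
    apply: eq_bigr => i _; rewrite -{2}(hsubmxK xi) /zvec /= -(splitK i).
    by case: (fintype.split i) => j /=; rewrite ?row_mxEl ?row_mxEr !mxE;
      rewrite ?row_mxEl ?row_mxEr ?mxE.
  rewrite mulr_sumr !mulr_suml -!big_split; apply: eq_bigr => i _ /=; ring.
have tE : (p + t *: hvec p xi).2 = p.2 + 2 * (\sum_i jvec p 0 i * xi 0 i) * t.
  rewrite /= [_ *: _]mulrC; congr (_ + 2 * _ * _).
  rewrite big_split_ord /= /dotv -sumrN; congr (_ + _); apply: eq_bigr => i _.
    by rewrite row_mxEl !mxE.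
  by rewrite row_mxEr !mxE mulNr.
rewrite /line_poly !(hornerD, hornerM, hornerC, hornerX, hornerXn, horner_exp).
by rewrite /gauge zE tE addrA.
Qed.

Lemma line_poly_deriv0 lam p xi :
  (line_poly lam p xi)^`().[0] =
  4 * (zsq p * (\sum_i zvec p 0 i * xi 0 i) + p.2 * \sum_i jvec p 0 i * xi 0 i).
Proof.
rewrite /line_poly !poly.derivE.
by rewrite !(hornerD, hornerM, hornerC, hornerX, hornerXn) /=; ring.
Qed.

Lemma line_poly_deriv20 lam p xi :
  (line_poly lam p xi)^`()^`().[0] =
  8 * (\sum_i zvec p 0 i * xi 0 i) ^+ 2 + 4 * zsq p * (\sum_i xi 0 i ^+ 2) +
  8 * (\sum_i jvec p 0 i * xi 0 i) ^+ 2.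
Proof.
rewrite /line_poly !poly.derivE.
by rewrite !(hornerD, hornerM, hornerC, hornerX, hornerXn) /=; ring.
Qed.

(** Up to the factor 4 s (lam + gauge)^(-s-1), this is the horizontal Hessian of
    -(lam + gauge)^(-s): with M = lam + gauge and the horizontal gradient
    4 w of the gauge, where w = |z|^2 z + t J, it equals
      |z|^2 I + 2 z z^T + 2 J J^T - (4 (s+1) / M) w w^T. *)
Definition gauge_hess lam s p : 'M[R]_(n + n) :=
  let a := zsq p in let e := 4 * (s + 1) / (lam + gauge p) in
  plane_mx (zvec p) (jvec p) a (2 - e * a ^+ 2) (2 - e * p.2 ^+ 2)
    (- (e * a * p.2)).

(** Both Hessians are read off from second derivatives along horizontal lines,
    where the difference of the two functions has a minimum. *)
Lemma hess_le_at_contact u lam s C p xi : classC2 u -> 0 < lam ->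
    (forall q, - u p - C * (lam + gauge p) `^ (- s) <=
               - u q - C * (lam + gauge q) `^ (- s)) ->
  qform (hess u p) xi <=
  4 * C * s * (lam + gauge p) `^ (- s - 1) * qform (gauge_hess lam s p) xi.
Proof.
move=> C2u lam0 pmin; have [[du _] du2] := C2u.
rewrite qform_hess //; set V := hvec p xi.
pose P := line_poly lam p xi.
have P0 t : 0 < P.[t] by rewrite -gauge_line ltr_pwDl // gauge_ge0.
have P0E : P.[0] = lam + gauge p by rewrite -gauge_line scale0r addr0.
pose f t := - u (p + t *: V); pose f' t := - 'D_V u (p + t *: V).
have df (t : R) : is_derive t 1 f (f' t).
  by apply: is_deriveN; apply: is_derive_line.
have df' : is_derive (0 : R) 1 f' (- 'D_V (fun q => 'D_V u q) p).
  apply: is_deriveN; rewrite -[in X in is_derive _ _ _ X](addr0 p) -(scale0r V).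
  by apply: is_derive_line; case: (du2 V).
have := @powR_touch_derive2 R P s C f f' _ P0 df df'.
rewrite opprK P0E => H; apply: le_trans (H _) _ => [t|].
  by rewrite -gauge_line /f scale0r addr0.
rewrite line_poly_deriv0 line_poly_deriv20 qform_plane_mx.
rewrite le_eqVlt; apply/orP; left; apply/eqP.
have := P0 0; rewrite P0E; set m := lam + gauge p => m0.
by field; rewrite gt_eqF.
Qed.

Lemma sigma2_gauge_hess lam s p : 0 < lam ->
  sigma 2 (gauge_hess lam s p) = zsq p ^+ 2 *
    (2 * n%:R ^+ 2 + 7 * n%:R
     - 4 * (s + 1) * (2 * n%:R + 1) * (gauge p / (lam + gauge p))).
Proof.
move=> lam0; rewrite sigma2_plane_mx ?sum_jvec_sqr ?sum_zvec_jvec //.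
have m0 : lam + gauge p != 0 by rewrite gt_eqF // ltr_pwDl // gauge_ge0.
rewrite natrD /gauge in m0 *.
by field.
Qed.

End Gauge.

(** * Existence of contact points *)

Section Contact.
Local Open Scope classical_set_scope.
Context {R : realType} {n : nat}.
Implicit Types (p q : heis R n) (u v : heis R n -> R) (lam s eps T : R).

Definition box T : set (heis R n) :=
  let cube := [set a : 'rV[R]_n | forall i, `[- T, T] (a ord0 i)] in
  (cube `*` cube) `*` `[- T, T].

Lemma box_compact T : compact (box T).
Proof.
apply: compact_setX; last exact: segment_compact.
by apply: compact_setX;
   apply: (@rV_compact _ _ (fun=> `[- T, T]%classic)) => _; exact: segment_compact.
Qed.

Lemma box_gauge T p : 1 <= T -> gauge p <= T -> box T p.
Proof.
move=> T1 gT.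
have sqT (c : R) : c ^+ 2 <= T -> `[- T, T] c.
  move=> cT; rewrite /= in_itv /= -ler_norml.
  have T0 : 0 <= T by exact: le_trans ler01 T1.
  rewrite -ler_sqr ?nnegrE //. rewrite real_normK ?num_real //.
  by apply: le_trans cT _; rewrite expr2 ler_peMr.
have zT : zsq p <= T.
  have := zsq_ge0 p; have := sqr_ge0 p.2; move: gT; rewrite /gauge; nra.
have zi i : (zvec p 0 i) ^+ 2 <= T.
  apply: le_trans zT; rewrite /zsq (bigD1 i) //= lerDl.
  by apply: sumr_ge0 => j _; exact: sqr_ge0.
split; last by apply: sqT; move: gT (sqr_ge0 (zsq p)); rewrite /gauge; lra.
split=> i; apply: sqT.
  by have := zi (lshift n i); rewrite row_mxEl.
by have := zi (rshift n i); rewrite row_mxEr.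
Qed.

Lemma gauge_continuous : continuous (@gauge R n).
Proof.
move=> p; apply: differentiable_continuous.
have dz i : differentiable (fun q : heis R n => zvec q 0 i) p.
  rewrite /zvec; rewrite -(splitK i); case: (fintype.split i) => j /=.
    under eq_fun do rewrite row_mxEl.
    exact: differentiable_x_coord.
  under eq_fun do rewrite row_mxEr.
  exact: differentiable_y_coord.
have dsq (f : heis R n -> R) :
    differentiable f p -> differentiable (fun q => f q ^+ 2) p.
  by move=> df; exact: (differentiableM df df).
apply: differentiableD; apply: (dsq _); last exact: differentiable_snd.
rewrite (_ : zsq = \sum_i (fun q => zvec q 0 i ^+ 2)); last first.
  by apply/funext => q; rewrite fct_sumE.
by apply: differentiable_sum => i; exact: dsq.
Qed.

Lemma gauge_powR_continuous lam s : 0 < lam ->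
  continuous (fun p : heis R n => (lam + gauge p) `^ s).
Proof.
move=> lam0 p.
have cg : {for p, continuous (fun q : heis R n => lam + gauge q)}.
  by apply: cvgD; [exact: cvg_cst|exact: gauge_continuous].
apply: (@continuous_comp _ _ _ (fun q : heis R n => lam + gauge q)
  (fun y => y `^ s)) => //.
apply/differentiable_continuous/derivable1_diffP.
have m0 : 0 < lam + gauge p by rewrite ltr_pwDl // gauge_ge0.
by case: (is_derive1_powR s m0).
Qed.

Lemma pos_lower_bound v T : continuous v -> (forall p, 0 < v p) ->
  exists2 m, 0 < m & forall p, gauge p <= T -> m <= v p.
Proof.
move=> cv v0; pose T1 := Num.max 1 T.
have T11 : 1 <= T1 by rewrite le_max lexx.
have ne : box T1 !=set0.
  by exists 0; apply: box_gauge => //; rewrite gauge0 (le_trans ler01).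
have [c cB cm] := compact_EVT_min ne (@box_compact T1) (continuous_subspaceT cv).
exists (v c) => // p pT; apply: cm; rewrite inE; apply: box_gauge => //.
by rewrite le_max pT orbT.
Qed.

(** The point p maximizes the quotient of the comparison function by v. The
    comparison function is nonpositive outside a compact box, because
    (lam + gauge)^(-s) <= eps as soon as gauge >= eps^(-1/s); so the maximum
    over the box is a maximum over the whole space. *)
Lemma contact_exists v lam s eps : continuous v -> (forall p, 0 < v p) ->
    0 < lam -> 0 < s -> 0 < eps -> eps < lam `^ (- s) ->
  exists p C, [/\ 0 < C, v p = C * ((lam + gauge p) `^ (- s) - eps) &
    forall q, C * ((lam + gauge q) `^ (- s) - eps) <= v q].
Proof.
move=> cv v0 lam0 s0 eps0 epslam.
pose f p := ((lam + gauge p) `^ (- s) - eps) / v p.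
pose T := Num.max 1 (eps `^ (- s^-1)).
have T1 : 1 <= T by rewrite le_max lexx.
have T0 : 0 < T by lra.
have cf : continuous f.
  move=> p; apply: cvgM.
    by apply: cvgB; [exact: gauge_powR_continuous|exact: cvg_cst].
  by apply: cvgV; [rewrite gt_eqF|exact: cv].
have f0 : 0 < f 0 by rewrite divr_gt0 // gauge0 addr0 subr_gt0.
have B0 : box T 0 by apply: box_gauge => //; rewrite gauge0 ltW.
have [p pB pmax] := compact_EVT_max (ex_intro _ _ B0) (@box_compact T)
  (continuous_subspaceT cf).
have fp0 : 0 < f p by apply: lt_le_trans f0 _; apply: pmax; rewrite inE.
have fmax q : f q <= f p.
  have [qT|qT] := leP (gauge q) T.
    by apply: pmax; rewrite inE; apply: box_gauge.
  apply: le_trans (ltW fp0); rewrite /f pmulr_lle0 ?invr_gt0 // subr_le0.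
  have TM : T <= lam + gauge q by lra.
  rewrite powRN -(invrK eps) lef_pV2 ?posrE ?powR_gt0 ?invr_gt0 //; last lra.
  have -> : eps^-1 = (eps `^ (- s^-1)) `^ s.
    by rewrite -powRrM mulNr mulVf ?gt_eqF // powR_inv1 // ltW.
  apply: ge0_ler_powR; rewrite ?nnegrE ?powR_ge0 //; [exact: ltW|lra|].
  by apply: le_trans TM; rewrite le_max lexx orbT.
exists p, (f p)^-1; split; first by rewrite invr_gt0.
  rewrite /f invf_div divfK // gt_eqF //.
  by move: fp0; rewrite /f pmulr_lgt0 ?invr_gt0.
move=> q; rewrite mulrC ler_pdivrMr // mulrC.
by rewrite -ler_pdivrMr // fmax.
Qed.

End Contact.

(** * Estimates for solutions *)

Section Liouville.
Context {R : realType} {n : nat}.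
Implicit Types (p q : heis R n) (u : heis R n -> R) (alpha lam s : R).

Let K : R := 2 * n%:R ^+ 2 + 7 * n%:R.

(** For this s the sigma_2 of [gauge_hess] is a nonnegative multiple of
    K - (K + 1) phi / (lam + phi). Positivity of sigma_2 (hess u p) forces
    phi < K lam. The upper bound uses |z|^4 <= phi <= lam + phi. *)
Lemma contact_estimate u alpha lam s p C : Gamma2 u -> u p < 0 ->
    sigma 2 (hess u p) = (- u p) `^ alpha ->
    0 < lam -> 0 < s -> 0 < C -> 4 * (s + 1) * (2 * n%:R + 1) = K + 1 ->
    (forall q, - u p - C * (lam + gauge p) `^ (- s) <=
               - u q - C * (lam + gauge q) `^ (- s)) ->
  gauge p < K * lam /\
  (- u p) `^ alpha <= 16 * K * s ^+ 2 * (C * (lam + gauge p) `^ (- s)) ^+ 2 / lam.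
Proof.
move=> [C2u Gu] up eqp lam0 s0 C0 sE pmin.
have v0 : 0 < (- u p) `^ alpha by rewrite powR_gt0 // oppr_gt0.
set g := gauge p in pmin *; set M := lam + g in pmin *.
have g0 : 0 <= g by exact: gauge_ge0.
have M0 : 0 < M by rewrite /M; lra.
set h := M `^ (- s) in pmin *.
have h0 : 0 < h by exact: powR_gt0.
have K0 : 0 <= K by rewrite /K addr_ge0 ?mulr_ge0 ?sqr_ge0.
set kap := 4 * C * s * M `^ (- s - 1).
have kapE : kap = 4 * C * s * h / M.
  rewrite /kap /h powRB ?powRr1 ?ltW // ?(gt_eqF M0) ?implybT //.
  by rewrite mulrA.
have symh i j : hess u p i j = hess u p j i by rewrite !mxE [X in X / _]addrC.
have symg i j : (kap *: gauge_hess lam s p) i j = (kap *: gauge_hess lam s p) j i.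
  by rewrite !mxE eq_sym; ring.
have : (- u p) `^ alpha <= kap ^+ 2 * (zsq p ^+ 2 * (K - (K + 1) * (g / M))).
  rewrite -eqp -sE -sigma2_gauge_hess // -sigma2Z; apply: sigma2_le => //.
  - exact: Gu.
  - exact: Gu.
  - by move=> x; rewrite qformZ; apply: hess_le_at_contact.
set r := g / M => H.
have r0 : 0 <= r by rewrite divr_ge0 // ltW.
have rM : r * M = g by rewrite divfK // gt_eqF.
have a0 : 0 <= kap ^+ 2 * zsq p ^+ 2 by rewrite mulr_ge0 ?sqr_ge0.
split.
  have : 0 < K - (K + 1) * r.
    rewrite ltNge; apply/negP => H'.
    have : kap ^+ 2 * (zsq p ^+ 2 * (K - (K + 1) * r)) <= 0.
      by rewrite mulrA mulr_ge0_le0.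
    by rewrite leNgt (lt_le_trans v0 H).
  rewrite -(pmulr_lgt0 _ M0) mulrBl -mulrA rM /M; lra.
apply: le_trans H _.
apply: (@le_trans _ _ (kap ^+ 2 * zsq p ^+ 2 * K)).
  rewrite mulrA; apply: ler_wpM2l => //.
  have := mulr_ge0 (addr_ge0 K0 ler01) r0; lra.
have zM : zsq p ^+ 2 <= M by rewrite /M /g /gauge; have := sqr_ge0 p.2; lra.
have {}zM : zsq p ^+ 2 / M ^+ 2 <= lam^-1.
  rewrite ler_pdivrMr ?exprn_gt0 // expr2 mulrA.
  apply: le_trans zM _; rewrite -[leLHS]mul1r ler_pM2r //.
  by rewrite ler_pdivlMl // mulr1 /M; lra.
rewrite kapE.
have -> : (4 * C * s * h / M) ^+ 2 * zsq p ^+ 2 * K =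
   (16 * K * s ^+ 2 * (C * h) ^+ 2) * (zsq p ^+ 2 / M ^+ 2).
  by field; rewrite gt_eqF.
apply: ler_wpM2l zM.
by rewrite !(mulr_ge0, sqr_ge0, exprn_ge0) // ltW.
Qed.

(** For lam = 1 the contact points stay in the bounded region gauge <= K, where v
    is bounded below; this bounds C below, uniformly in eps. *)
Lemma solution_lower_bound u alpha s : Gamma2 u -> (forall p, u p < 0) ->
    (forall p, sigma 2 (hess u p) = (- u p) `^ alpha) ->
    0 < s -> 4 * (s + 1) * (2 * n%:R + 1) = K + 1 ->
  exists2 m, 0 < m & forall q, m * (1 + gauge q) `^ (- s) <= - u q.
Proof.
move=> Gu u0 equ s0 sE.
have cv : continuous (fun q => - u q).
  move=> q; apply: continuousN; apply: differentiable_continuous.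
  by case: Gu => [[[]]].
have v0 q : 0 < - u q by rewrite oppr_gt0.
have [m m0 mK] := pos_lower_bound K cv v0.
exists (m / 2) => [|q]; first by rewrite divr_gt0.
have h1 p : (1 + gauge p) `^ (- s) <= 1.
  rewrite -[leRHS](powRr0 (1 + gauge p)); apply: ler_powR; last by lra.
  by have := gauge_ge0 p; lra.
(* eps = h / 2 still leaves half of the comparison function at q. *)
set h := (1 + gauge q) `^ (- s).
have h0 : 0 < h by rewrite powR_gt0 // ltr_pwDl // gauge_ge0.
have [||p [C [C0 pE Cle]]] := @contact_exists _ _ _ 1 s (h / 2) cv v0 ltr01 s0.
- by rewrite divr_gt0.
- by rewrite powR1 /=; have := h1 q; rewrite -/h; lra.
have [|gp _] := contact_estimate Gu (u0 p) (equ p) ltr01 s0 C0 sE.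
  by move=> r; have := Cle r; rewrite pE; lra.
rewrite mulr1 in gp.
have := mK p (ltW gp); have := Cle q; have := h1 p; rewrite pE -/h.
set h' := (1 + gauge p) `^ _ => h'1 Cq mC.
have mC1 : m <= C by nra.
have := ler_wpM2r (ltW h0) mC1; lra.
Qed.

(** The numbers x are the values of v at contact points p for large lam. The
    upper bound on x holds because the comparison function is largest at the
    origin. *)
Lemma solution_scaled_values u alpha s : Gamma2 u -> (forall p, u p < 0) ->
    (forall p, sigma 2 (hess u p) = (- u p) `^ alpha) ->
    0 < s -> 4 * (s + 1) * (2 * n%:R + 1) = K + 1 ->
  exists m V D : R, [/\ 0 < m, 0 < V, 0 < D & forall lam, 1 <= lam ->
    exists x : R, [/\ m * lam `^ (- s) <= x, x <= V &
      x `^ alpha <= D * x ^+ 2 / lam]].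
Proof.
move=> Gu u0 equ s0 sE.
have [m m0 mle] := solution_lower_bound Gu u0 equ s0 sE.
have cv : continuous (fun q => - u q).
  move=> q; apply: continuousN; apply: differentiable_continuous.
  by case: Gu => [[[]]].
have v0 q : 0 < - u q by rewrite oppr_gt0.
have K0 : 0 <= K by rewrite /K addr_ge0 ?mulr_ge0 ?sqr_ge0.
exists (m * (K + 1) `^ (- s)), (- u 0), (64 * K * s ^+ 2 + 1); split => //.
- by rewrite mulr_gt0 // powR_gt0 //; lra.
- by rewrite ltr_wpDl // !(mulr_ge0, sqr_ge0) // ltW.
move=> lam lam1; have lam0 : 0 < lam by lra.
have anti (a b : R) : 0 < a -> a <= b -> b `^ (- s) <= a `^ (- s).
  move=> a0 ab; rewrite !powRN lef_pV2 ?posrE ?powR_gt0 //; last by lra.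
  by apply: ge0_ler_powR; rewrite ?nnegrE //; lra.
(* Contact occurs where lam + gauge <= (K + 1) lam, so eps = L / 2 makes the
   comparison function at least C (lam + gauge)^(-s) / 2 there. *)
set L := ((K + 1) * lam) `^ (- s).
have L0 : 0 < L by rewrite powR_gt0 // mulr_gt0 //; lra.
have Llam : L <= lam `^ (- s) by apply: anti => //; nra.
have [||p [C [C0 pE Cle]]] := @contact_exists _ _ _ lam s (L / 2) cv v0 lam0 s0.
- by rewrite divr_gt0.
- by lra.
have [|gp est] := contact_estimate Gu (u0 p) (equ p) lam0 s0 C0 sE.
  by move=> r; have := Cle r; rewrite pE; lra.
have g0 := gauge_ge0 p.
have ML : L <= (lam + gauge p) `^ (- s) by apply: anti; lra.
have Mlam : (lam + gauge p) `^ (- s) <= lam `^ (- s) by apply: anti; lra.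
exists (- u p); split.
- rewrite -mulrA -powRM; [|lra|lra].
  apply: le_trans (mle p); rewrite ler_pM2l //; apply: anti; nra.
- have := Cle 0; rewrite gauge0 addr0 pE; apply: le_trans.
  by rewrite ler_pM2l //; lra.
apply: le_trans est _; rewrite ler_pM2r ?invr_gt0 //.
set M := (lam + gauge p) `^ (- s) in pE ML *.
have CM : C * M <= 2 * (- u p) by rewrite pE; nra.
have CM0 : 0 <= C * M by rewrite mulr_ge0 ?powR_ge0 // ltW.
have CM2 : (C * M) ^+ 2 <= 4 * (- u p) ^+ 2 by nra.
have c0 : 0 <= 16 * K * s ^+ 2 by rewrite !(mulr_ge0, sqr_ge0) // ltW.
have := ler_wpM2l c0 CM2; have := sqr_ge0 (- u p); nra.
Qed.

End Liouville.

(** The last inequality reads lam x^(alpha-2) <= D. If alpha <= 2 the left side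
    is at least lam V^(alpha-2); otherwise it is at least a positive multiple of
    lam^(1 - s (alpha-2)). Both are unbounded in lam. *)
Lemma subcritical_contradiction (R : realType) (alpha s m V D : R) :
    0 < m -> 0 < V -> 0 < D -> 0 < s -> s * (alpha - 2) < 1 ->
    (forall lam, 1 <= lam -> exists x : R,
      [/\ m * lam `^ (- s) <= x, x <= V & x `^ alpha <= D * x ^+ 2 / lam]) ->
  False.
Proof.
move=> m0 V0 D0 s0 sub H.
suff [c [d [c0 d0 cd]]] : exists c d : R, [/\ 0 < c, 0 < d &
    forall lam, 1 <= lam -> c * lam `^ d <= D].
  have Dc : 0 < D / c by rewrite divr_gt0.
  have := cd ((D / c + 1) `^ d^-1).
  rewrite -powRrM mulVf ?gt_eqF // powRr1 ?mulrDr ?mulr1; last by lra.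
  rewrite mulrCA divff ?gt_eqF // mulr1 => cdL.
  have : D + c <= D; last by lra.
  apply: cdL; rewrite -[leLHS](powRr0 (D / c + 1)); apply: ler_powR; first lra.
  by rewrite invr_ge0 ltW.
have key lam : 1 <= lam -> exists x : R,
    [/\ 0 < x, m * lam `^ (- s) <= x, x <= V & lam * x `^ (alpha - 2) <= D].
  move=> lam1; have lam0 : 0 < lam by lra.
  have [x [x1 x2 x3]] := H lam lam1.
  have x0 : 0 < x by apply: lt_le_trans x1; rewrite mulr_gt0 // powR_gt0.
  exists x; split => //.
  rewrite powRB ?(gt_eqF x0) ?implybT // powR_mulrn ?(ltW x0) //.
  move: x3; rewrite ler_pdivlMr // => x3.
  by rewrite mulrA ler_pdivrMr ?exprn_gt0 // mulrC.
have [a2|a2] := leP alpha 2.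
  exists (V `^ (alpha - 2)), 1; split => // [|lam lam1]; first exact: powR_gt0.
  have [x [x0 _ x2 x3]] := key lam lam1.
  apply: le_trans x3; rewrite powRr1; last lra.
  rewrite mulrC ler_pM2l; last lra.
  rewrite -opprB !powRN lef_pV2 ?posrE ?powR_gt0 //.
  by apply: ge0_ler_powR; rewrite ?nnegrE //; lra.
exists (m `^ (alpha - 2)), (1 - s * (alpha - 2)); split => [||lam lam1].
- exact: powR_gt0.
- by lra.
have lam0 : 0 < lam by lra.
have [x [x0 x1 _ x3]] := key lam lam1.
apply: le_trans x3; rewrite [lam `^ _]powRB ?(gt_eqF lam0) ?implybT //.
rewrite powRr1; last exact: ltW.
rewrite mulrCA ler_pM2l //.
rewrite -[(lam `^ _)^-1]powRN -mulNr powRrM -powRM ?powR_ge0 ?(ltW m0) //.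
apply: ge0_ler_powR; rewrite ?nnegrE ?mulr_ge0 ?powR_ge0 //; lra.
Qed.

Theorem theorem1p1 (R : realType) (n : nat) (hn : (1 <= n)%N)
    (hQ : (4 < homdim n)%N) (alpha : R)
    (halpha : alpha <= 2 * (homdim n)%:R / ((homdim n)%:R - 4)) :
  ~ exists u : heis R n -> R,
      [/\ Gamma2 u,
          (forall p, u p < 0) &
          (forall p, sigma 2 (hess u p) = (- u p) `^ alpha)].
Proof.
case=> u [Gu u0 equ].
have n2 : (2 <= n)%N by move: hQ; rewrite /homdim; case: (n) hn => [|[|]].
have n2R : 2 <= n%:R :> R by rewrite (ler_nat R 2 n).
pose s : R := (2 * n%:R ^+ 2 + 7 * n%:R + 1) / (4 * (2 * n%:R + 1)) - 1.
have N0 : 0 < 2 * n%:R + 1 :> R by lra.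
have sE : 4 * (s + 1) * (2 * n%:R + 1) = (2 * n%:R ^+ 2 + 7 * n%:R) + 1.
  by rewrite /s; field; rewrite gt_eqF.
have s0 : 0 < s by nra.
have s4 : 4 * s < n%:R - 1 by nra.
have [m [V [D [m0 V0 D0 H]]]] := solution_scaled_values Gu u0 equ s0 sE.
apply: (subcritical_contradiction m0 V0 D0 s0 _ H).
have crit : 2 * (homdim n)%:R / ((homdim n)%:R - 4) - 2 = 4 / (n%:R - 1) :> R.
  by rewrite /homdim natrD natrM; field; apply/andP; split; rewrite gt_eqF //; lra.
have a2 : alpha - 2 <= 4 / (n%:R - 1) by rewrite -crit lerB.
apply: (le_lt_trans (ler_wpM2l (ltW s0) a2)).
by rewrite mulrA ltr_pdivrMr; lra.
Qed.
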